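(* Let $F$ be a (fixed) graph with at least one edge and let $r=r(F)$. Then, for each fixed real number $p\in(0,1)$, with high probability, $$\mathrm{sat}\big(\mathbb{G}(n,p),F\big)\geqslant\frac{r-1}{2}n-\big(r-1+o(1)\big)\log_{\frac{1}{1-p}}n.$$
   Context: All graphs are finite, undirected, without loops or multiple edges. For a graph $F$, $r(F)=\min_{xy\in E(F)}\max\{d(x),d(y)\}$, where $d(x)$ is the degree of $x$ in $F$. For graphs $G$ and $F$, a graph is $F$-free if it has no subgraph (not necessarily induced) isomorphic to $F$. A spanning subgraph $H$ of $G$ is an $F$-saturated subgraph of $G$ if $H$ is $F$-free and adding any edge of $E(G)\setminus E(H)$ to $H$ creates a copy of $F$. $\mathrm{sat}(G,F)$ denotes the minimum number of edges in an $F$-saturated subgraph of $G$. $\mathbb{G}(n,p)$ is the Erdős–Rényi random graph on a fixed vertex set of size $n$, where every two distinct vertices are adjacent independently with probability $p$. ''With high probability'' means with probability tending to $1$ as $n\to\infty$. The term $o(1)$ denotes a function of $n$ (depending on the fixed $p$ and $F$) tending to $0$ as $n\to\infty$. *)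

(* Defs.v *)
From HB Require Import structures.
From mathcomp Require Import all_boot all_order all_algebra.
From mathcomp Require Import reals exp.

Set Implicit Arguments.
Unset Strict Implicit.
Unset Printing Implicit Defensive.

Import Order.TTheory GRing.Theory Num.Theory.

Local Open Scope ring_scope.

Record sgraph (V : finType) := SGraph {
  edges : {set {set V}};
  _ : [forall e in edges, #|e| == 2]
}.

HB.instance Definition _ (V : finType) := [isSub for @edges V].
HB.instance Definition _ (V : finType) := [Equality of sgraph V by <:].
HB.instance Definition _ (V : finType) := [Choice of sgraph V by <:].
HB.instance Definition _ (V : finType) := [Countable of sgraph V by <:].
HB.instance Definition _ (V : finType) := [Finite of sgraph V by <:].

Definition deg (V : finType) (G : sgraph V) (x : V) : nat :=
  #|[set e in edges G | x \in e]%SET|.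

(* All degrees are smaller than #|V|, so the default value #|V| never wins
   once G has an edge. *)
Definition min_max_deg (V : finType) (G : sgraph V) : nat :=
  \big[minn/#|V|]_(e in edges G) (\max_(x in e) deg G x)%N.

(* The host is given by its bare edge set so that an edge can be added to it. *)
Definition has_copy (U V : finType) (F : sgraph U) (E : {set {set V}}) : bool :=
  [exists f : {ffun U -> V},
     injectiveb f && [forall e in edges F, (f @: e)%SET \in E]].

Definition saturated_in (U V : finType) (F : sgraph U) (G H : sgraph V) : bool :=
  [&& edges H \subset edges G,
      ~~ has_copy F (edges H)
    & [forall e in (edges G :\: edges H)%SET, has_copy F (e |: edges H)%SET]].

(* Subgraphs of G have at most #|edges G| edges, so the default value does not
   affect the minimum; saturated subgraphs exist as soon as F has an edge, see
   sat_attained. *)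
Definition sat (U V : finType) (G : sgraph V) (F : sgraph U) : nat :=
  \big[minn/#|edges G|]_(H : sgraph V | saturated_in F G H) #|edges H|.

(* The law of the random graph on V is the product, over all pairs of distinct
   vertices, of Bernoulli laws of parameter p; see gnp_indep. *)
Definition gnp_weight (R : realType) (V : finType) (p : R) (G : sgraph V) : R :=
  \prod_(e : {set V} | #|e| == 2) (if e \in edges G then p else 1 - p).

Definition gnp_prob (R : realType) (V : finType) (p : R) (A : pred (sgraph V)) : R :=
  \sum_(G : sgraph V | A G) gnp_weight p G.

Definition logb (R : realType) (b x : R) : R := ln x / ln b.

Lemma sum_sgraph_prod (R : realType) (V : finType) (f : {set V} -> bool -> R) :
  \sum_(G : sgraph V) \prod_(e : {set V} | #|e| == 2) f e (e \in edges G)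
  = \prod_(e : {set V} | #|e| == 2) (f e true + f e false).
Proof.
have edgesP (G : sgraph V) e : e \in edges G -> #|e| == 2.
  by move=> eG; have /forall_inP := valP G; apply.
pose g (e : {set V}) (b : bool) : R := if #|e| == 2 then f e b else (~~ b)%:R.
have gE e : \sum_(b : bool) g e b = if #|e| == 2 then f e true + f e false else 1.
  by rewrite (bigD1 true) //= (bigD1 false) //= big1 ?addr0 ?/g; [case: ifP => //; rewrite add0r | case].
rewrite [RHS]big_mkcond /= -(eq_bigr _ (fun e _ => gE e)) bigA_distr_bigA /=.
pose P (h : {ffun {set V} -> bool}) := [forall e, h e ==> (#|e| == 2)].
rewrite [RHS](bigID P) /= [X in _ + X]big1 ?addr0; last first.
  move=> h /forallPn[e]; rewrite negb_imply => /andP[he ne].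
  by rewrite (bigD1 e) //= /g (negbTE ne) he mul0r.
pose to_h (G : sgraph V) := [ffun e => e \in edges G] : {ffun {set V} -> bool}.
have ofP (h : {ffun {set V} -> bool}) :
    [forall e in [set e | h e && (#|e| == 2)]%SET, #|e| == 2].
  by apply/forall_inP => e; rewrite inE => /andP[].
rewrite (reindex to_h) /=; last first.
  exists (fun h => SGraph (ofP h)) => [G _|h /forallP hP].
    apply/val_inj/setP => e; rewrite inE ffunE /=.
    by apply: andb_idr => /edgesP.
  by apply/ffunP => e; rewrite ffunE inE; apply: andb_idr; apply/implyP/hP.
apply: eq_big => [G|G _].
  by symmetry; apply/forallP => e; rewrite ffunE; apply/implyP/edgesP.
rewrite big_mkcond; apply: eq_bigr => e _; rewrite /g ffunE; case: ifP => // ne.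
by case: (boolP (e \in edges G)) => // /edgesP; rewrite ne.
Qed.

Lemma gnp_prob_total (R : realType) (V : finType) (p : R) :
  gnp_prob p (fun _ : sgraph V => true) = 1.
Proof.
rewrite /gnp_prob /gnp_weight (sum_sgraph_prod (fun _ b => if b then p else 1 - p)).
by rewrite big1 // => e _; rewrite addrC subrK.
Qed.

Lemma gnp_indep (R : realType) (V : finType) (p : R) (A : {set {set V}}) :
  {in A, forall e : {set V}, #|e| = 2} ->
  gnp_prob p (fun G : sgraph V => A \subset edges G) = p ^+ #|A|.
Proof.
move=> A2; pose f (e : {set V}) b := if b then p else if e \in A then 0 else 1 - p.
transitivity (\sum_(G : sgraph V)
    \prod_(e : {set V} | #|e| == 2) f e (e \in edges G)).
  rewrite /gnp_prob big_mkcond; apply: eq_bigr => G _; case: ifPn => [AG|].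
    apply: eq_bigr => e _; rewrite /f; case: ifPn => // eG.
    by case: ifPn => // /(subsetP AG); rewrite (negbTE eG).
  case/subsetPn => e eA eG; rewrite (bigD1 e) ?A2 //= /f (negbTE eG) eA.
  by rewrite mul0r.
rewrite sum_sgraph_prod (bigID (mem A)) /= [X in _ * X]big1 ?mulr1; last first.
  by move=> e /andP[_ eA]; rewrite /f (negbTE eA) addrC subrK.
rewrite -prodr_const; apply: eq_big => [e|e /andP[_ eA]].
  by apply: andb_idl => /A2 ->.
by rewrite /f eA addr0.
Qed.

Lemma sat_attained (U V : finType) (F : sgraph U) (G : sgraph V) :
  edges F != set0 ->
  exists2 H : sgraph V, saturated_in F G H & #|edges H| = sat G F.
Proof.
move=> /set0Pn[e0 e0F].
pose P (E : {set {set V}}) := (E \subset edges G) && ~~ has_copy F E.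
have P0 : P set0.
  rewrite /P sub0set /=; apply/existsPn => f; rewrite negb_and; apply/orP; right.
  by apply/forall_inPn; exists e0 => //; rewrite inE.
have [E /maxsetP[/andP[EG EF] Emax] _] := maxset_exists P0.
have E2 : [forall e in E, #|e| == 2].
  apply/forall_inP => e /(subsetP EG) eG.
  by have /forall_inP := valP G; apply.
have Hsat : saturated_in F G (SGraph E2).
  rewrite /saturated_in /= EG EF /=; apply/forall_inP => e.
  rewrite !inE => /andP[eE eG]; apply: contraNT eE => nc.
  have <- : (e |: E)%SET = E.
    by apply: Emax; rewrite ?subsetUr // /P subUset sub1set eG EG.
  exact: setU11.
have le_sat (H : sgraph V) : saturated_in F G H -> (#|edges H| <= #|edges G|)%N.
  by case/and3P => /subset_leq_card.
pose H := [arg min_(H < SGraph E2 | saturated_in F G H) #|edges H|]%N.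
have [/= HS Hmin] : saturated_in F G H /\
    forall K, saturated_in F G K -> (#|edges H| <= #|edges K|)%N.
  by rewrite /H; case: arg_minnP.
exists H => //; apply/eqP; rewrite eqn_leq; apply/andP; split.
  rewrite /sat; elim/big_ind: _ => [|x y Hx Hy|K /Hmin //].
    exact: le_sat.
  by rewrite leq_min Hx.
rewrite /sat; have: H \in index_enum (sgraph V) by rewrite mem_index_enum.
elim: (index_enum _) => // K r IHr; rewrite inE big_cons => /predU1P[<-|/IHr le_r].
  by rewrite HS geq_minl.
by case: ifP => // _; apply: leq_trans (geq_minr _ _) le_r.
Qed.

(* Main.v *)
(* Write k = r - 1 and let H be an F-saturated subgraph of G.  The edge added to
   H plays the role of some edge of F, so one of its ends has H-degree at least
   k.  Hence the set L of vertices of H-degree less than k induces the same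
   edges in G as in H, and every L' included in L spans at most k * #|L'| edges
   of G.  A first-moment bound shows that whp no set of M + 1 vertices of G(n,p)
   is that sparse, where, with u = sqrt (ln n) and c = - ln (1 - p),
   M = (2 / c) (u ^ 2 + O(u)) = (2 + o(1)) log_(1/(1-p)) n.  Then #|L| <= M, and
   summing degrees outside L gives 2 #|edges H| >= k (n - M). *)

Require Import Defs.
From mathcomp Require Import all_boot all_order all_algebra.
From mathcomp Require Import all_classical all_reals all_analysis.
From mathcomp Require Import ring lra.

Set Implicit Arguments.
Unset Strict Implicit.
Unset Printing Implicit Defensive.

Import Order.TTheory GRing.Theory Num.Theory.
Import numFieldNormedType.Exports.

Local Open Scope classical_set_scope.
Local Open Scope ring_scope.

(** * Degrees and saturated subgraphs *)

Lemma edge_card2 (V : finType) (G : sgraph V) (e : {set V}) :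
  e \in edges G -> #|e| = 2%N.
Proof. by move=> eG; apply/eqP; have /forall_inP := valP G; apply. Qed.

Lemma handshake (V : finType) (G : sgraph V) :
  (\sum_(x : V) deg G x = (#|edges G|).*2)%N.
Proof.
transitivity (\sum_(x : V) \sum_(e in edges G) (x \in e))%N.
  apply: eq_bigr => x _; rewrite /deg -sum1_card big_mkcond [RHS]big_mkcond /=.
  by apply: eq_bigr => e _; rewrite inE; case: (e \in edges G) => //=; case: ifP.
rewrite exchange_big /= -muln2 -sum_nat_const; apply: eq_bigr => e eG.
by rewrite -(edge_card2 eG) -sum1_card [RHS]big_mkcond /=; apply: eq_bigr => x _; case: ifP.
Qed.

Lemma min_max_deg_le (V : finType) (G : sgraph V) (e : {set V}) :
  e \in edges G -> (min_max_deg G <= \max_(x in e) deg G x)%N.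
Proof. 
rewrite /min_max_deg; have: e \in index_enum {set V} by rewrite mem_index_enum.
elim: (index_enum _) => // a s IHs; rewrite inE big_cons => /predU1P[<-|/IHs le_s] eG.
  by rewrite eG geq_minl.
by case: ifP => _; [apply: leq_trans (geq_minr _ _) _|]; exact: le_s.
Qed.

Lemma min_max_deg_gt0 (V : finType) (G : sgraph V) :
  edges G != finset.set0 -> (0 < min_max_deg G)%N.
Proof.
move=> /set0Pn[e eG].
have pick_in e' : e' \in edges G -> exists x, x \in e'.
  by move=> /edge_card2 e2; apply/card_gt0P; rewrite e2.
rewrite /min_max_deg; elim/big_ind: _ => [|a b a0 b0|e' e'G].
(* The default value [#|V|] of the minimum must be positive too: an end of an edge witnesses it. *)
- by have [x _] := pick_in _ eG; apply/card_gt0P; exists x.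
- by rewrite leq_min a0.
have [x xe'] := pick_in _ e'G; apply: leq_trans (leq_bigmax_cond _ xe').
by apply/card_gt0P; exists e'; rewrite inE e'G.
Qed.

(** Since [H] is [F]-free, the copy created by [e] maps some edge [e0] of [F] onto [e]. Take [x] of
    largest degree in [e0]: the edges of [F] at [x] go injectively to [e] and edges of [H] at [f x],
    so only one of them can be missing from [H]. *)
Lemma saturated_deg (U V : finType) (F : sgraph U) (G H : sgraph V)
    (e : {set V}) :
  saturated_in F G H -> e \in edges G -> e \notin edges H ->
  exists2 y, y \in e & (min_max_deg F <= (deg H y).+1)%N.
Proof.
case/and3P => _ Hfree /forall_inP Hsat eG eH.
have /existsP[f /andP[/injectiveP f_inj /forall_inP fF]] : has_copy F (e |: edges H)%SET.
  by apply: Hsat; rewrite inE eH.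
have [e0 e0F fe0] : exists2 e0, e0 \in edges F & (f @: e0)%SET \notin edges H.
  apply/exists_inP; apply: contraR Hfree => /exists_inPn fH.
  apply/existsP; exists f; apply/andP; split; first exact/injectiveP.
  by apply/forall_inP => a /fH; rewrite negbK.
have fe0e : (f @: e0)%SET = e.
  by have := fF _ e0F; rewrite !inE (negbTE fe0) orbF => /eqP.
have [x xe0 max_x] : exists2 x, x \in e0 & (\max_(z in e0) deg F z)%N = deg F x.
  have [|x xe0 ->] := @eq_bigmax_cond _ (mem e0) (deg F); last by exists x.
  by rewrite (edge_card2 e0F).
exists (f x); first by rewrite -fe0e imset_f.
apply: leq_trans (min_max_deg_le e0F) _; rewrite max_x /deg.
rewrite -(card_imset _ (imset_inj f_inj)).
apply: (@leq_trans #|e |: [set a in edges H | f x \in a]|%SET); last first.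
  by rewrite cardsU1 -add1n leq_add2r leq_b1.
apply/subset_leq_card/fintype.subsetP => b /imsetP[a aFx b_eq].
have {aFx} [aF xa] : a \in edges F /\ x \in a by move: aFx; rewrite inE => /andP.
rewrite {}b_eq.
have := fF _ aF; rewrite !inE => /orP[->//|->].
by rewrite imset_f ?orbT.
Qed.

Definition inner_edges (V : finType) (G : sgraph V) (L : {set V}) : {set {set V}} :=
  [set e in edges G | e \subset L]%SET.

Lemma sat_lower_bound (U V : finType) (F : sgraph U) (G : sgraph V) (k m : nat) :
  edges F != finset.set0 -> min_max_deg F = k.+1 ->
  (forall L : {set V}, #|L| = m.+1 -> (k * m.+1 < #|inner_edges G L|)%N) ->
  (k * #|V| <= (sat G F).*2 + k * m)%N.
Proof.
move=> F_edge rF dense; have [H Hsat <-] := sat_attained G F_edge.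
pose L := [set x | deg H x < k]%SET%N.
have leL : (#|L| <= m)%N.
  rewrite leqNgt; apply/negP => ltmL.
  (* Density is assumed for sets of size exactly [m.+1], so [L] is cut down to such a set. *)
  have [L' L'L cL'] : exists2 L' : {set V}, L' \subset L & #|L'| = m.+1.
    have : (0 < #|[set A : {set V} | A \subset L & #|A| == m.+1]%SET|)%N.
      by rewrite cards_draws bin_gt0.
    by case/card_gt0P => A; rewrite inE => /andP[AL /eqP cA]; exists A.
  have := dense _ cL'; rewrite ltnNge => /negP; apply.
  apply: (@leq_trans (\sum_(x in L') deg H x)%N); last first.
    rewrite mulnC -cL' -sum_nat_const; apply: leq_sum => x /(fintype.subsetP L'L).
    by rewrite inE => /ltnW.
  (* Every edge of [G] inside [L'] lies in [H], hence in the [H]-star of one of its ends. *)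
  apply: (@leq_trans #|\bigcup_(x in L') [set e in edges H | x \in e]%SET|%SET).
    apply/subset_leq_card/fintype.subsetP => e; rewrite inE => /andP[eG eL'].
    have eH : e \in edges H.
      apply/contraT => eH; have [y ye] := saturated_deg Hsat eG eH.
      rewrite rF ltnS leqNgt => /negP[].
      by have := fintype.subsetP L'L _ (fintype.subsetP eL' _ ye); rewrite inE.
    have /card_gt0P[x xe] : (0 < #|e|)%N by rewrite (edge_card2 eG).
    apply/bigcupP; exists x; first exact: (fintype.subsetP eL').
    by rewrite inE eH.
  rewrite /deg; elim/big_rec2: _ => [|x n A _ IH]; first by rewrite cards0.
  by rewrite (leq_trans (leq_card_setU _ _)) // leq_add2l.
(* Vertices of [L] are paid for by [k * m]; each vertex outside [L] contributes at least [k] to the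
   degree sum. *)
rewrite -handshake -(cardsC L) mulnDr addnC leq_add ?leq_mul //.
apply: (@leq_trans (\sum_(x in ~: L) deg H x)%N); last first.
  by rewrite [X in (_ <= X)%N](bigID (mem (~: L)%SET)) /= leq_addr.
by rewrite mulnC -sum_nat_const; apply: leq_sum => x; rewrite !inE -leqNgt.
Qed.

(** * Tail bounds in the random graph *)

Lemma ffact_le_expn (n m : nat) : (n ^_ m <= n ^ m)%N.
Proof. by elim: m => // m IHm; rewrite ffactnSr expnSr leq_mul // leq_subr. Qed.

Section Gnp.
Variables (R : realType) (V : finType) (p : R).
Hypothesis p01 : 0 < p < 1.

Lemma gnp_weight_ge0 (G : sgraph V) : 0 <= gnp_weight p G.
Proof.
by apply: prodr_ge0 => e _; case: ifP => _; move: p01; lra.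
Qed.

Lemma gnp_prob_le (A B : pred (sgraph V)) :
  subpred A B -> gnp_prob p A <= gnp_prob p B.
Proof.
move=> AB; rewrite /gnp_prob [X in _ <= X](bigID A) /=.
rewrite [X in _ <= X + _](eq_bigl A); last by move=> G; apply/andb_idl/AB.
by rewrite lerDl sumr_ge0 // => G _; exact: gnp_weight_ge0.
Qed.

Lemma gnp_probC (A : pred (sgraph V)) :
  gnp_prob p A = 1 - gnp_prob p (predC A).
Proof.
rewrite -(gnp_prob_total V p) /gnp_prob [X in _ = X - _](bigID A) /=.
by rewrite addrK.
Qed.

Lemma gnp_prob_exists (I : finType) (P : pred I) (A : I -> pred (sgraph V)) :
  gnp_prob p (fun G => [exists i, P i && A i G]) <= \sum_(i | P i) gnp_prob p (A i).
Proof.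
rewrite /gnp_prob (exchange_big_dep predT) //= big_mkcond; apply: ler_sum => G _.
have term_ge0 i : P i && A i G -> 0 <= gnp_weight p G by move=> _; exact: gnp_weight_ge0.
case: ifP => [/existsP[i PAi]|_]; last exact: sumr_ge0.
by rewrite (bigD1 i) //= lerDl sumr_ge0 // => j _; exact: gnp_weight_ge0.
Qed.

(* Chernoff's method: Markov's inequality for [x ^+ #|inner_edges G L|],
   whose expectation factors over the pairs inside [L]. *)
Lemma gnp_few_inner_edges (x : R) (L : {set V}) (t : nat) :
  0 < x <= 1 ->
  gnp_prob p (fun G => #|inner_edges G L| <= t)%N
    <= x ^- t * (1 - p + p * x) ^+ 'C(#|L|, 2).
Proof.
move=> /andP[x0 x1].
(* Tilting the Bernoulli factors inside [L] by [x] turns the expectation into a product; pairs not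
   inside [L] contribute a factor 1. *)
pose f (e : {set V}) b := (if b then p else 1 - p) * (if b && (e \subset L) then x else 1).
have -> : (1 - p + p * x) ^+ 'C(#|L|, 2) = \sum_(G : sgraph V)
    \prod_(e : {set V} | #|e| == 2) f e (e \in edges G).
  rewrite sum_sgraph_prod (bigID (fun e : {set V} => e \subset L)) /= [X in _ = _ * X]big1 ?mulr1.
    rewrite -(cards_draws L 2) -prodr_const; apply: eq_big => [e|e].
      by rewrite inE andbC.
    by rewrite inE => /andP[eL _]; rewrite /f eL /= mulr1 addrC.
  by move=> e /andP[_ /negbTE eL]; rewrite /f eL /= !mulr1 addrC subrK.
rewrite mulr_sumr /gnp_prob big_mkcond; apply: ler_sum => G _.
have -> : \prod_(e : {set V} | #|e| == 2) f e (e \in edges G)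
    = gnp_weight p G * x ^+ #|inner_edges G L|.
  rewrite big_split /=; congr (_ * _); rewrite -big_mkcondr /= -prodr_const.
  apply: eq_bigl => e; rewrite inE; apply: andb_idl => /andP[eG _].
  by rewrite (edge_card2 eG).
have w0 := gnp_weight_ge0 G.
case: ifP => [le_t|_]; last by rewrite mulr_ge0 ?mulr_ge0 ?invr_ge0 ?exprn_ge0 // ltW.
rewrite mulrCA ler_peMr // mulrC ler_pdivlMr ?exprn_gt0 // mul1r.
by apply: ler_wiXn2l => //; exact: ltW.
Qed.

(** Union bound over the vertex sets of size [m], whose number is at most [#|V| ^ m]. *)
Lemma gnp_sparse_set (x : R) (m t : nat) :
  0 < x <= 1 ->
  gnp_prob p (fun G => [exists L : {set V}, (#|L| == m) && (#|inner_edges G L| <= t)%N])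
    <= #|V|%:R ^+ m * (x ^- t * (1 - p + p * x) ^+ 'C(m, 2)).
Proof.
move=> x01; apply: le_trans (gnp_prob_exists _ _) _.
apply: (@le_trans _ _ (\sum_(L : {set V} | #|L| == m)
    (x ^- t * (1 - p + p * x) ^+ 'C(m, 2)))).
  by apply: ler_sum => L /eqP <-; exact: gnp_few_inner_edges.
rewrite sumr_const -[X in X <= _]mulr_natl ler_wpM2r //.
  by rewrite mulr_ge0 ?invr_ge0 ?exprn_ge0 //; move: p01 x01; nra.
rewrite -natrX ler_nat.
have -> : #|[pred L : {set V} | #|L| == m]| = 'C(#|V|, m).
  rewrite -cardsT -(cards_draws [set: V]%SET m) cardsE.
  by apply: eq_card => L; rewrite !inE unfold_in finset.subsetT.
apply: leq_trans (ffact_le_expn _ m).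
by rewrite -bin_ffact leq_pmulr ?fact_gt0.
Qed.

End Gnp.

(** * Choice of the parameters and asymptotics *)

Lemma ln_invC_gt0 (R : realType) (p : R) : 0 < p < 1 -> 0 < ln (1 / (1 - p)).
Proof. by move=> p01; rewrite ln_gt0 // ltr_pdivlMr; lra. Qed.

(* [expR (- u)] is the Chernoff parameter: it tends to 0, so that
   [1 - p + p * expR (- u)] is close to [1 - p], but slowly enough that
   [expR (- u) ^- (k * M.+1)] stays negligible against [n%:R ^+ M.+1]. *)
Lemma first_moment_le (R : realType) (p c s D u : R) (k n M : nat) :
  0 < p < 1 -> c = ln (1 / (1 - p)) -> s = p / (1 - p) -> D = k%:R + s / c + 2 ->
  (0 < n)%N -> u ^+ 2 = ln n%:R -> s * D / c + s / 2 + 1 <= u ->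
  2 / c * (u ^+ 2 + D * u) <= M%:R <= 2 / c * (u ^+ 2 + D * u) + 1 ->
  n%:R ^+ M.+1 * (expR (- u) ^- (k * M.+1) * (1 - p + p * expR (- u)) ^+ 'C(M.+1, 2))
    <= expR (- u).
Proof.
move=> p01 cE sE DE n0 u2 u_large /andP[leM geM].
have c0 : 0 < c by rewrite cE ln_invC_gt0.
have q0 : 0 < 1 - p by move: p01; lra.
have s0 : 0 < s by rewrite sE divr_gt0 //; move: p01; lra.
have D0 : 0 < D by rewrite DE ltr_wpDl // addr_ge0 // divr_ge0 // ltW.
have u1 : 1 <= u.
  have := divr_ge0 (mulr_ge0 (ltW s0) (ltW D0)) (ltW c0); lra.
have nE : n%:R = expR (u ^+ 2) by rewrite u2 lnK // posrE ltr0n.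
have lam_le : u * expR (- u) <= 1.
  rewrite expRN ler_pdivrMr ?expR_gt0 // mul1r; apply: le_trans (expR_ge1Dx u); lra.
(* The left side is [(1 - p) * (1 + s * expR (- u))], and [1 - p = expR (- c)]. *)
have factor_le : 1 - p + p * expR (- u) <= expR (- c + s * expR (- u)).
  rewrite expRD cE -lnV ?posrE ?divr_gt0 // lnK ?posrE ?invr_gt0 ?divr_gt0 //.
  rewrite div1r invrK; apply: le_trans (ler_wpM2l (ltW q0) (expR_ge1Dx _)).
  by rewrite mulrDr mulr1 mulrA sE [_ * (p / _)]mulrC divfK ?gt_eqF.
have binE : 'C(M.+1, 2)%:R = M.+1%:R * (M%:R / 2) :> R.
  apply: (mulIf (_ : 2 != 0)); rewrite ?pnatr_eq0 // mulrA divfK ?pnatr_eq0 //.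
  by rewrite -!natrM; have := bin_ffact M.+1 2; rewrite ffactnS ffactn1 => ->.
(* Every exponent is a multiple of [M.+1]; factoring it out leaves one bracket, which only has to be
   at most [- u]. *)
have le_expR : n%:R ^+ M.+1 * (expR (- u) ^- (k * M.+1)
      * (1 - p + p * expR (- u)) ^+ 'C(M.+1, 2))
    <= expR (M.+1%:R * (u ^+ 2 + k%:R * u + (M%:R / 2) * (- c + s * expR (- u)))).
  have -> : M.+1%:R * (u ^+ 2 + k%:R * u + (M%:R / 2) * (- c + s * expR (- u)))
      = M.+1%:R * u ^+ 2
        + ((k * M.+1)%:R * u + 'C(M.+1, 2)%:R * (- c + s * expR (- u))).
    by rewrite binE natrM; ring.
  rewrite expRD expRM_natl -nE ler_wpM2l ?exprn_ge0 // expRD.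
  rewrite -exprVn expRN invrK expRM_natl ler_wpM2l ?exprn_ge0 ?expR_ge0 //.
  rewrite expRM_natl lerXn2r ?nnegrE ?expR_ge0 -?expRN //.
  by rewrite addr_ge0 ?mulr_ge0 ?expR_ge0 //; move: p01; lra.
apply: le_trans le_expR _; rewrite ler_expR.
suff bracket : u ^+ 2 + k%:R * u + (M%:R / 2) * (- c + s * expR (- u)) <= - u.
  apply: le_trans (ler_wpM2l _ bracket) _ => //.
  by rewrite mulrN lerN2 ler_peMl ?ler1n // (le_trans ler01).
have cM : u ^+ 2 + D * u <= c * M%:R / 2.
  have := ler_wpM2l (ltW c0) leM.
  have -> : c * (2 / c * (u ^+ 2 + D * u)) = 2 * (u ^+ 2 + D * u) by field; exact: lt0r_neq0.
  lra.
(* Although [M] is quadratic in [u], the bound [u * expR (- u) <= 1] makes this error linear in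
   [u]. *)
have lamM : M%:R * expR (- u) <= 2 / c * (u + D) + 1.
  apply: le_trans (ler_wpM2r (expR_ge0 _) geM) _.
  have -> : (2 / c * (u ^+ 2 + D * u) + 1) * expR (- u)
    = 2 / c * (u + D) * (u * expR (- u)) + expR (- u) by ring.
  apply: lerD; last by rewrite expR_le1; lra.
  apply: ler_piMr lam_le; apply: mulr_ge0; [exact: divr_ge0 (ltW c0)|lra].
have slamM := ler_wpM2l (ltW s0) lamM.
have E : s * (2 / c * (u + D) + 1) = 2 * (s / c) * u + 2 * (s * D / c) + s by ring.
rewrite {}E in slamM.
(* The three summands of [D] cancel [k * u], cancel the linear error [s / c * u], and leave
   [- 2 * u]: one [u] absorbs the constants through [u_large], the other is the bound claimed. *)
have DuE : D * u = k%:R * u + s / c * u + 2 * u by rewrite DE; ring.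
rewrite DuE in cM.
have -> : u ^+ 2 + k%:R * u + M%:R / 2 * (- c + s * expR (- u))
  = u ^+ 2 + k%:R * u - c * M%:R / 2 + s * (M%:R * expR (- u)) / 2 by field.
lra.
Qed.

Lemma cvg_sqrt_ln (R : realType) : Num.sqrt (ln (n%:R : R)) @[n --> \oo] --> +oo.
Proof.
apply/cvgryPge => A; near=> n.
have le_n : expR (A ^+ 2) <= n%:R by near: n; exact: cvgry_ge (@cvgr_idn R) _.
apply: le_trans (ler_norm A) _; rewrite -sqrtr_sqr ler_wsqrtr //.
rewrite -(expRK (A ^+ 2)) ler_ln // posrE ?expR_gt0 //.
exact: lt_le_trans (expR_gt0 _) le_n.
Unshelve. all: by end_near.
Qed.

Theorem corollary3p3 (R : realType) (U : finType) (F : sgraph U)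
    (F_edge : edges F != finset.set0) (p : R) (p01 : 0 < p < 1) :
  exists2 eps : nat -> R,
    eps n @[n --> \oo] --> (0 : R) &
    gnp_prob p (fun G : sgraph 'I_n =>
      ((min_max_deg F)%:R - 1) / 2 * n%:R
        - ((min_max_deg F)%:R - 1 + eps n) * logb (1 / (1 - p)) n%:R
      <= (sat G F)%:R) @[n --> \oo] --> (1 : R).
Proof.
have [k kE] : exists k, min_max_deg F = k.+1.
  by exists (min_max_deg F).-1; rewrite prednK // min_max_deg_gt0.
have -> : (min_max_deg F)%:R - 1 = k%:R :> R by rewrite kE -natr1 addrK.
pose c := ln (1 / (1 - p)); have c0 : 0 < c by exact: ln_invC_gt0.
pose s := p / (1 - p); pose D := k%:R + s / c + 2.
have s0 : 0 < s by rewrite /s divr_gt0; move: p01; lra.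
have D0 : 0 < D by rewrite ltr_wpDl // addr_ge0 // divr_ge0 // ltW.
pose u n := Num.sqrt (ln (n%:R : R)).
have uy : u n @[n --> \oo] --> +oo by exact: cvg_sqrt_ln.
have uV0 : (u n)^-1 @[n --> \oo] --> 0.
  by apply/gtr0_cvgV0 => //; exact: cvgry_gt uy _.
(* With [ln n = u n ^+ 2], this error makes the subtracted term exactly [k * (x + 1) / 2] for the
   [x] below, which dominates [k * M / 2]. *)
exists (fun n => k%:R * D * (u n)^-1 + k%:R * c / 2 * ((u n)^-1 * (u n)^-1)).
  rewrite -[X in _ --> X](_ : k%:R * D * 0 + k%:R * c / 2 * (0 * 0) = 0); last by ring.
  apply: cvgD; first exact: cvgMr.
  by apply: cvgMr; exact: cvgM.
(* The failure probability is at most [expR (- u n)], hence at most [(u n)^-1]. *)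
apply: (@squeeze_cvgr _ _ _ _ (fun n => 1 - (u n)^-1) (fun=> 1)); last first.
- exact: cvg_cst.
- by rewrite -[X in _ --> X]subr0; apply: cvgB => //; exact: cvg_cst.
near=> n.
have n0 : (0 < n)%N by near: n; exact: nbhs_infty_gt.
have un0 : 0 < u n by near: n; exact: cvgry_gt uy _.
have u_large : s * D / c + s / 2 + 1 <= u n by near: n; exact: cvgry_ge uy _.
have u2 : u n ^+ 2 = ln n%:R by rewrite sqr_sqrtr // ln_ge0 // ler1n.
apply/andP; split; last first.
  by rewrite -(gnp_prob_total 'I_n p); exact: gnp_prob_le.
pose x := 2 / c * (u n ^+ 2 + D * u n); pose M := (Num.trunc x).+1.
have xM : x <= M%:R <= x + 1.
  have x0 : 0 <= x.
    by apply: mulr_ge0; [exact: divr_ge0 (ltW c0) | rewrite addr_ge0 ?mulr_ge0 ?sqr_ge0 // ltW].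
  have /andP[le_x lt_x] := truncn_itv x0.
  by rewrite (ltW lt_x) /M -natr1 lerD2r.
rewrite gnp_probC // lerD2l lerN2.
apply: (@le_trans _ _ (expR (- u n))); last first.
  by rewrite expRN lef_pV2 ?posrE ?expR_gt0 //; apply: le_trans (expR_ge1Dx _); lra.
have lam01 : 0 < expR (- u n) <= 1 by rewrite expR_gt0 expR_le1; lra.
have fm := first_moment_le p01 erefl erefl erefl n0 u2 u_large xM.
apply: le_trans fm.
have := @gnp_sparse_set R 'I_n p p01 _ M.+1 (k * M.+1) lam01.
rewrite card_ord; apply: le_trans.
(* By contraposition: a graph without a sparse set of [M.+1] vertices satisfies the lower bound on
   [sat]. *)
apply: gnp_prob_le => // G /=; apply: contraR => /existsPn dense.
have := @sat_lower_bound _ _ F G k M F_edge kE.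
have {}dense (L : {set 'I_n}) : #|L| = M.+1 -> (k * M.+1 < #|inner_edges G L|)%N.
  by move=> cL; have := dense L; rewrite cL eqxx /= -ltnNge.
move=> /(_ dense); rewrite card_ord -(ler_nat R) natrD -muln2 !natrM => le_sat.
rewrite /logb -/c -u2.
have -> : (k%:R + (k%:R * D * (u n)^-1 + k%:R * c / 2 * ((u n)^-1 * (u n)^-1)))
    * (u n ^+ 2 / c) = k%:R * (x + 1) / 2.
  by rewrite /x; field; rewrite !gt_eqF.
have /andP[_ /(ler_wpM2l (ler0n R k))] := xM; lra.
Unshelve. all: by end_near.
Qed.
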